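(* Let $X,U$ be Banach spaces, let $A$ generate a $C_0$-semigroup $(T(t))_{t\ge 0}$ on $X$, and let $B:U\to X_{-1}$ be linear and bounded. If $\Sigma(A,B)$ is $L^\infty$-iISS, then $\Sigma(A,B)$ is $L^\infty$-zero-class admissible.
   Context: System. $X_{-1}$ is the completion of $X$ with respect to $\|x\|_{X_{-1}}=\|(\beta-A)^{-1}x\|_X$ for some $\beta\in\rho(A)$; $(T(t))_{t\ge0}$ extends uniquely to a $C_0$-semigroup $(T_{-1}(t))_{t\ge0}$ on $X_{-1}$, whose generator $A_{-1}$ extends $A$. $\Sigma(A,B)$ denotes the system $\dot x(t)=Ax(t)+Bu(t)$, $x(0)=x_0$, $t\ge 0$. Its mild solution for $x_0\in X$ and input $u$ is $x(t)=T(t)x_0+\int_0^tT_{-1}(t-s)Bu(s)\,ds$, which in general is an element of $X_{-1}$. $\|\cdot\|$ without index is the norm of $X$. Comparison functions ($\mathbb R_0^+=[0,\infty)$). $\mathcal K$: functions $\mu:\mathbb R_0^+\to\mathbb R_0^+$ that are continuous, strictly increasing, with $\mu(0)=0$. $\mathcal K_\infty$: $\theta\in\mathcal K$ with $\lim_{x\to\infty}\theta(x)=\infty$. $\mathcal L$: continuous strictly decreasing $\gamma:\mathbb R_0^+\to\mathbb R_0^+$ with $\lim_{t\to\infty}\gamma(t)=0$. $\mathcal{KL}$: $\beta:(\mathbb R_0^+)^2\to\mathbb R_0^+$ with $\beta(\cdot,t)\in\mathcal K$ for all $t\ge0$ and $\beta(s,\cdot)\in\mathcal L$ for all $s>0$.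 $L^\infty$-iISS: there are $\beta\in\mathcal{KL}$, $\theta\in\mathcal K_\infty$, $\mu\in\mathcal K$ such that for every $t\ge0$, $x_0\in X$, $u\in L^\infty(0,t;U)$ one has $x(t)\in X$ and $\|x(t)\|\le\beta(\|x_0\|,t)+\theta\left(\int_0^t\mu(\|u(s)\|_U)\,ds\right)$. $\Sigma(A,B)$ is $L^\infty$-admissible if $\int_0^tT_{-1}(s)Bu(s)\,ds\in X$ for all $t>0$, $u\in L^\infty(0,t;U)$; then $c(t)$ denotes the smallest constant with $\left\|\int_0^tT_{-1}(s)Bu(s)\,ds\right\|\le c(t)\|u\|_{L^\infty(0,t;U)}$ for all such $u$. It is $L^\infty$-zero-class admissible if it is $L^\infty$-admissible and $\lim_{t\to0}c(t)=0$. *)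

(* Defs.v *)
From HB Require Import structures.
From mathcomp Require Import all_boot all_order all_algebra.
From mathcomp Require Import all_classical all_reals all_analysis.
From mathcomp Require Import ess_sup_inf complex.

Set Implicit Arguments.
Unset Strict Implicit.
Unset Printing Implicit Defensive.

Import Order.TTheory GRing.Theory Num.Theory.
Import numFieldNormedType.Exports.

Local Open Scope classical_set_scope.
Local Open Scope ring_scope.

(* Banach spaces are over the real or the complex field.  A normed module over
   K has a K-valued norm, hence the real-valued [rnorm]. *)
Variant scalar_kind := RealScalars | ComplexScalars.

Definition scalars (R : realType) (k : scalar_kind) : numFieldType :=
  match k with
  | RealScalars => R
  | ComplexScalars => R[i]
  end.

Definition of_real (R : realType) (k : scalar_kind) : R -> scalars R k :=
  match k with
  | RealScalars => fun r => r
  | ComplexScalars => fun r => real_complex R r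
  end.

Definition re_part (R : realType) (k : scalar_kind) : scalars R k -> R :=
  match k with
  | RealScalars => fun z => z
  | ComplexScalars => fun z => complex.Re z
  end.

Definition rnorm (R : realType) (k : scalar_kind)
  (V : normedModType (scalars R k)) (x : V) : R := re_part `|x|.

Section ComparisonFunctions.
Context {R : realType}.

(* Functions on [0, +oo) are functions on R of which only the values on
   [0, +oo) matter. *)
Definition class_K (f : R -> R) : Prop :=
  [/\ {within `[0, +oo[, continuous f},
      (forall x y, 0 <= x -> x < y -> f x < f y) & f 0 = 0].

Definition class_Koo (f : R -> R) : Prop :=
  class_K f /\ f x @[x --> +oo] --> +oo.

Definition class_L (f : R -> R) : Prop :=
  [/\ {within `[0, +oo[, continuous f},
      (forall x, 0 <= x -> 0 <= f x),
      (forall x y, 0 <= x -> x < y -> f y < f x) &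
      f x @[x --> +oo] --> 0].

Definition class_KL (f : R -> R -> R) : Prop :=
  (forall t, 0 <= t -> class_K (fun s => f s t)) /\
  (forall s, 0 < s -> class_L (f s)).

End ComparisonFunctions.

Section BochnerIntegral.
Context {R : realType} {k : scalar_kind} {V : normedModType (scalars R k)}.

Local Notation leb := (@lebesgue_measure R).

(* The list [:: (E_1, v_1); ...; (E_n, v_n)] represents sum_i 1_{E_i} v_i. *)
Definition simple_rep := seq (set R * V).

Definition simple_measurable (s : simple_rep) : Prop :=
  forall i, (i < size s)%N -> measurable (nth (set0, 0) s i).1.

Definition simple_eval (s : simple_rep) (x : R) : V :=
  \sum_(p <- s) (\1_(p.1) x : scalars R k) *: p.2.

Definition simple_integral (D : set R) (s : simple_rep) : V :=
  \sum_(p <- s) of_real k (fine (leb (p.1 `&` D))) *: p.2.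

Definition simple_approx (D : set R) (f : R -> V) (s : nat -> simple_rep) :
  Prop :=
  (forall n, simple_measurable (s n)) /\
  {ae leb, forall x, D x -> simple_eval (s n) x @[n --> \oo] --> f x}.

Definition strongly_measurable (D : set R) (f : R -> V) : Prop :=
  exists s, simple_approx D f s.

(* [is_bochner_integral D f v]: f is Bochner integrable on D, of integral v.
   Intended for D measurable of finite measure. *)
Definition is_bochner_integral (D : set R) (f : R -> V) (v : V) : Prop :=
  exists s : nat -> simple_rep,
    [/\ simple_approx D f s,
        (\int[leb]_(x in D) (rnorm (f x - simple_eval (s n) x))%:E)%E
          @[n --> \oo] --> 0%E &
        simple_integral D (s n) @[n --> \oo] --> v].

(* The essential supremum of the norm over (0, t). *)
Definition Loo_norm (t : R) (u : R -> V) : \bar R :=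
  ess_sup leb (fun x => (\1_(`]0, t[%classic : set R) x * rnorm (u x))%:E).

Definition in_Loo (t : R) (u : R -> V) : Prop :=
  strongly_measurable `]0, t[ u /\ (Loo_norm t u < +oo)%E.

End BochnerIntegral.

Section Semigroups.
Context {R : realType} {k : scalar_kind}.
Local Notation K := (scalars R k).

Definition bounded_operator (V W : normedModType K) (f : {linear V -> W}) :
  Prop :=
  exists M : R, forall x, rnorm (f x) <= M * rnorm x.

(* Only the values [T t] for t >= 0 matter. *)
Definition C0_semigroup (V : normedModType K) (T : R -> {linear V -> V}) :
  Prop :=
  [/\ (forall t, 0 <= t -> bounded_operator (T t)),
      (forall x, T 0 x = x),
      (forall s t x, 0 <= s -> 0 <= t -> T (s + t) x = T s (T t x)) &
      (forall x, T t x @[t --> 0^'+] --> x)].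

(* Possibly unbounded operators; [op] is only meaningful on [dom]. *)
Record operator (V : normedModType K) := Operator {
  dom : set V;
  op : V -> V }.

Definition generates (V : normedModType K) (A : operator V)
  (T : R -> {linear V -> V}) : Prop :=
  forall x y : V,
    (dom A x /\ op A x = y) <->
    ((of_real k h)^-1 *: (T h x - x) @[h --> 0^'+] --> y).

(* [is_resolvent A b S]: b is in the resolvent set of A and S = (b - A)^-1. *)
Definition is_resolvent (V : normedModType K) (A : operator V) (b : K)
  (S : {linear V -> V}) : Prop :=
  [/\ bounded_operator S,
      (forall x, dom A (S x) /\ b *: S x - op A (S x) = x) &
      (forall x, dom A x -> S (b *: x - op A x) = x)].

(* [iota] exhibits the Banach space W as the completion X_{-1} of V for the
   norm x |-> ||(b - A)^-1 x||. *)
Definition is_extrapolation_space (V : normedModType K) (A : operator V)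
  (W : completeNormedModType K) (iota : {linear V -> W}) : Prop :=
  (exists (b : K) (S : {linear V -> V}),
     is_resolvent A b S /\ forall x, rnorm (iota x) = rnorm (S x)) /\
  dense (range iota).

Definition is_extrapolated_semigroup (V W : normedModType K)
  (T : R -> {linear V -> V}) (iota : {linear V -> W})
  (Tm1 : R -> {linear W -> W}) : Prop :=
  C0_semigroup Tm1 /\
  forall t x, 0 <= t -> Tm1 t (iota x) = iota (T t x).

End Semigroups.

Section System.
Context {R : realType} {k : scalar_kind}.
Local Notation K := (scalars R k).
Context {X U Xm1 : normedModType K}.
Variables (T : R -> {linear X -> X}) (iota : {linear X -> Xm1}).
Variables (Tm1 : R -> {linear Xm1 -> Xm1}) (B : {linear U -> Xm1}).

Local Notation leb := (@lebesgue_measure R).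

(* x(t) = T(t) x0 + int_0^t T_{-1}(t - s) B u(s) ds *)
Definition is_mild_solution_at (x0 : X) (u : R -> U) (t : R) (xt : Xm1) :
  Prop :=
  exists2 v : Xm1,
    is_bochner_integral `]0, t[ (fun s => Tm1 (t - s) (B (u s))) v &
    xt = iota (T t x0) + v.

Definition Loo_iISS : Prop :=
  exists (beta : R -> R -> R) (theta mu : R -> R),
    [/\ class_KL beta, class_Koo theta, class_K mu &
      forall (t : R) (x0 : X) (u : R -> U), 0 <= t -> in_Loo t u ->
      exists2 x : X, is_mild_solution_at x0 u t (iota x) &
        rnorm x <= beta (rnorm x0) t
                   + theta (\int[leb]_(s in `]0, t[) mu (rnorm (u s)))].

(* int_0^t T_{-1}(s) B u(s) ds lies in X and equals x there *)
Definition is_input_integral (t : R) (u : R -> U) (x : X) : Prop :=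
  is_bochner_integral `]0, t[ (fun s => Tm1 s (B (u s))) (iota x).

Definition Loo_admissible : Prop :=
  forall (t : R) (u : R -> U), 0 < t -> in_Loo t u ->
  exists x : X, is_input_integral t u x.

(* The smallest constant c(t), as an extended real (+oo if there is none). *)
Definition admissibility_constant (t : R) : \bar R :=
  ereal_inf [set c%:E | c in [set c : R | 0 <= c /\
    forall u : R -> U, in_Loo t u ->
    forall x : X, is_input_integral t u x ->
    rnorm x <= c * fine (Loo_norm t u)]].

Definition Loo_zero_class_admissible : Prop :=
  Loo_admissible /\ admissibility_constant t @[t --> 0^'+] --> 0%E.

End System.

(* Main.v *)
From HB Require Import structures.
Require Import Defs.
From mathcomp Require Import all_boot all_order all_algebra.
From mathcomp Require Import all_classical all_reals all_analysis.
From mathcomp Require Import measurable_realfun ess_sup_inf complex.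

Set Implicit Arguments.
Unset Strict Implicit.
Unset Printing Implicit Defensive.

Import Order.TTheory GRing.Theory Num.Theory.
Import numFieldNormedType.Exports.

Local Open Scope classical_set_scope.
Local Open Scope ring_scope.

(* Take x0 = 0.  As beta 0 t = 0, an input with |u| <= M almost everywhere
   steers 0 into the ball of radius theta (t mu(M)) of X.  Reflecting time,
   s |-> t - s, turns the mild solution into the input integral, and normalizing
   u makes the bound linear: c(t) <= theta (t mu(1)), which tends to 0 with t.
   Since c(t) quantifies over every value of the integral, this also needs the
   uniqueness of Bochner integrals and the injectivity of iota. *)

(** * Real-valued norms over either scalar field *)

Section RealPart.
Context {R : realType} {k : scalar_kind}.
Local Notation K := (scalars R k).

Lemma of_realK : cancel (@of_real R k) (@re_part R k).
Proof. by case: k. Qed.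

Lemma re_partK (z : K) : 0 <= z -> of_real k (re_part z) = z.
Proof. by case: k z => //= z z0; rewrite RRe_real// ger0_real. Qed.

Lemma ler_of_real (a b : R) : (of_real k a <= of_real k b) = (a <= b).
Proof. by case: k => //=; rewrite lecR. Qed.

Lemma ltr_of_real (a b : R) : (of_real k a < of_real k b) = (a < b).
Proof. by case: k => //=; rewrite ltcR. Qed.

Lemma of_realD (a b : R) : of_real k (a + b) = of_real k a + of_real k b.
Proof. by case: k => //=; rewrite rmorphD. Qed.

Lemma of_realM (a b : R) : of_real k (a * b) = of_real k a * of_real k b.
Proof. by case: k => //=; rewrite rmorphM. Qed.

Lemma of_real0 : of_real k (0 : R) = 0.
Proof. by case: k => //=; rewrite rmorph0. Qed.

Lemma of_real1 : of_real k (1 : R) = 1.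
Proof. by case: k => //=; rewrite rmorph1. Qed.

Context {V : normedModType K}.
Implicit Types x y : V.

Lemma rnormK x : of_real k (rnorm x) = `|x|.
Proof. exact: re_partK. Qed.

Lemma rnorm_ge0 x : 0 <= rnorm x.
Proof. by rewrite -ler_of_real of_real0 rnormK. Qed.

Lemma rnorm0 : rnorm (0 : V) = 0.
Proof. by rewrite /rnorm normr0 -of_real0 of_realK. Qed.

Lemma rnorm_eq0 x : rnorm x = 0 -> x = 0.
Proof. by move=> x0; apply/normr0_eq0; rewrite -rnormK x0 of_real0. Qed.

Lemma rnormN x : rnorm (- x) = rnorm x.
Proof. by rewrite /rnorm normrN. Qed.

Lemma rnorm_distC x y : rnorm (x - y) = rnorm (y - x).
Proof. by rewrite -rnormN opprB. Qed.

Lemma ler_rnormD x y : rnorm (x + y) <= rnorm x + rnorm y.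
Proof. by rewrite -ler_of_real of_realD !rnormK ler_normD. Qed.

Lemma ler_rnorm_dist x y : `|rnorm x - rnorm y| <= rnorm (x - y).
Proof.
have le_dist (a b : V) : rnorm a - rnorm b <= rnorm (a - b).
  by rewrite lerBlDr; apply: le_trans (ler_rnormD _ _); rewrite subrK.
by rewrite ler_norml lerNl opprB {1}rnorm_distC !le_dist.
Qed.

Lemma rnormZ (c : K) x : rnorm (c *: x) = re_part `|c| * rnorm x.
Proof.
apply: (can_inj of_realK).
by rewrite of_realM !rnormK normrZ re_partK.
Qed.

Lemma rnormZ_real (a : R) x : 0 <= a -> rnorm (of_real k a *: x) = a * rnorm x.
Proof.
move=> a0; rewrite rnormZ ger0_norm ?of_realK//.
by rewrite -of_real0 ler_of_real.
Qed.

Lemma cvg_rnormP {T : Type} {F : set_system T} {FF : Filter F} (f : T -> V) x :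
  f @ F --> x <-> rnorm (x - f t) @[t --> F] --> 0.
Proof.
split=> [/cvgrPdist_lt fx|fx].
  apply/cvgrPdist_lt => e e0.
  have /fx : 0 < of_real k e by rewrite -of_real0 ltr_of_real.
  apply: filterS => t; rewrite -rnormK ltr_of_real.
  by rewrite sub0r normrN ger0_norm ?rnorm_ge0.
apply/cvgrPdist_lt => e e0.
(* A positive element of [K] is real, also over the complex field, so its real part serves as the
   tolerance. *)
have e0' : 0 < re_part e by rewrite -ltr_of_real re_partK ?of_real0 ?ltW.
move/cvgrPdist_lt : fx => /(_ _ e0'); apply: filterS => t.
rewrite sub0r normrN ger0_norm ?rnorm_ge0// -ltr_of_real rnormK re_partK//.
exact: ltW.
Qed.

End RealPart.

(** * Comparison of integrals of nonnegative functions *)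

Section LowerIntegral.
Context d {T : measurableType d} {R : realType}.
Variable mu : {measure set T -> \bar R}.
Local Open Scope ereal_scope.

Import HBNNSimple.

(* For nonnegative functions the library's integral is the supremum of the
   integrals of the simple functions below, hence monotone even when the
   functions are not measurable. *)
Lemma ae_le_nonneg_integral (D : set T) (f g : T -> \bar R) :
  measurable D -> (forall x, D x -> 0 <= f x) -> (forall x, D x -> 0 <= g x) ->
  {ae mu, forall x, D x -> f x <= g x} ->
  \int[mu]_(x in D) f x <= \int[mu]_(x in D) g x.
Proof.
move=> mD f0 g0 [N [mN muN fgN]].
rewrite ge0_integralE// ge0_integralE//.
apply: ge_ereal_sup => _ [h /= hf <-].
have mNC : measurable (~` N) by exact: measurableC.
(* Cutting [h] off on the null set [N] puts it below [g] everywhere and leaves its integral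
   unchanged. *)
apply: ereal_sup_ubound; exists (proj_nnsfun h mNC) => /=.
  move=> x; have := hf x; rewrite /patch; case: ifPn => xD hfx.
    rewrite /= mindicE; case: (boolP (x \in ~` N)) => xN.
      rewrite mulr1; apply: (le_trans hfx).
      apply: contrapT => fgx; move: xN; rewrite inE; apply; apply: fgN => /=.
      by apply/not_implyP; split => //; rewrite -inE.
    by rewrite mulr0 g0// -inE.
  have -> : h x = 0%R by apply/eqP; rewrite eq_le -!lee_fin hfx lee_fin/=.
  by rewrite mul0r.
rewrite -[RHS]integralT_nnsfun (ge0_negligible_integral mN)//; last 2 first.
- exact/measurable_EFinP.
- by move=> x _; rewrite lee_fin.
by rewrite setTD integral_nnsfun// (mrestrict _ mNC).
Qed.

Lemma ae_eq_nonneg_integral (D : set T) (f g : T -> \bar R) :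
  measurable D -> (forall x, D x -> 0 <= f x) -> (forall x, D x -> 0 <= g x) ->
  {ae mu, forall x, D x -> f x = g x} ->
  \int[mu]_(x in D) f x = \int[mu]_(x in D) g x.
Proof.
move=> mD f0 g0 fg; apply/eqP; rewrite eq_le.
by rewrite !ae_le_nonneg_integral//; apply: filterS fg => x + Dx => ->.
Qed.

End LowerIntegral.

(** * Time reflection and Lebesgue measure *)

Section Reflection.
Context {R : realType}.
Local Notation leb := (@lebesgue_measure R).

Lemma ae_lebesgueS (P Q : R -> Prop) : (forall x, P x -> Q x) ->
  {ae leb, forall x, P x} -> {ae leb, forall x, Q x}.
Proof. by move=> PQ; exact: (@filterS _ _ (ae_filter_ringOfSetsType leb)). Qed.

Lemma ae_lebesgueS2 (P P' Q : R -> Prop) : (forall x, P x -> P' x -> Q x) ->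
  {ae leb, forall x, P x} -> {ae leb, forall x, P' x} ->
  {ae leb, forall x, Q x}.
Proof. by move=> PQ; exact: (@filterS2 _ _ (ae_filter_ringOfSetsType leb)). Qed.

Definition reflect_at (t : R) : measurableTypeR R -> measurableTypeR R :=
  fun x => t - x.

Lemma measurable_reflect_at t : measurable_fun setT (reflect_at t).
Proof. exact: measurable_funB. Qed.

HB.instance Definition _ (t : R) :=
  isMeasurableFun.Build _ _ _ _ (reflect_at t) (measurable_reflect_at t).

Lemma measurable_preimage_reflect_at t (A : set R) :
  measurable A -> measurable (reflect_at t @^-1` A).
Proof.
by move=> mA; rewrite -[X in measurable X]setTI; exact: measurable_reflect_at.
Qed.

(** By uniqueness of Lebesgue measure it suffices to test the pushforward on the intervals ]a, b],
    whose preimages [t - b, t - a[ have the same length. *)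
Lemma lebesgue_measure_reflect_at t (A : set R) : measurable A ->
  leb (reflect_at t @^-1` A) = leb A.
Proof.
move=> mA; rewrite -[LHS]/(pushforward leb (reflect_at t) A); apply/esym.
apply: lebesgue_measure_unique => // _ [[a b]] _ <-.
rewrite /pushforward /=.
rewrite [X in _ = leb X](_ : _ = [set` `[t - b, t - a[]); last first.
  apply/seteqP; split=> x; rewrite /= /reflect_at !in_itv/=.
    by rewrite ltrBrDl -ltrBrDr lerBlDl -lerBlDr andbC.
  by rewrite ltrBrDl -ltrBrDr lerBlDl -lerBlDr andbC.
rewrite !lebesgue_measure_itv/= !lte_fin ltrD2l ltrN2.
by case: ifP => // _; rewrite -!EFinB opprB [in RHS]addrC addrA subrK.
Qed.

Lemma ae_reflect_at t (P : R -> Prop) :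
  {ae leb, forall x, P x} -> {ae leb, forall x, P (t - x)}.
Proof.
move=> [N [mN N0 PN]]; exists (reflect_at t @^-1` N); split.
- exact: measurable_preimage_reflect_at.
- by rewrite /= lebesgue_measure_reflect_at.
- by move=> x /= Px; exact: PN.
Qed.

Lemma reflect_at_itv (t : R) :
  reflect_at t @^-1` `]0, t[%classic = `]0, t[%classic.
Proof.
by apply/seteqP; split=> x; rewrite /= /reflect_at !in_itv/=;
  rewrite subr_gt0 ltrBlDr ltrDl andbC.
Qed.

Lemma reflect_at_itv_mem (t x : R) :
  `]0, t[%classic x -> `]0, t[%classic (t - x).
Proof. by rewrite -[X in X x -> _]reflect_at_itv. Qed.

(** The interval is its own preimage, so the left side is an integral against the pushforward
    measure, which is again Lebesgue measure. *)
Lemma integral_reflect_at (t : R) (f : R -> \bar R) :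
  measurable_fun (`]0, t[ : set R) f -> (forall x, 0 <= f x)%E ->
  (\int[leb]_(x in `]0%R, t[) f (t - x)%R = \int[leb]_(x in `]0%R, t[) f x)%E.
Proof.
move=> mf f0.
transitivity (\int[leb]_(x in reflect_at t @^-1` `]0%R, t[)
    (f \o reflect_at t) x)%E.
  by rewrite reflect_at_itv.
rewrite -(ge0_integral_pushforward (measurable_reflect_at t))//.

by apply: eq_measure_integral => A mA _; exact: lebesgue_measure_reflect_at.
Qed.

End Reflection.

(** * Vector-valued simple functions and their integrals *)

Section SimpleFunctions.
Context {R : realType} {k : scalar_kind} {V : normedModType (scalars R k)}.
Local Notation K := (scalars R k).
Local Notation leb := (@lebesgue_measure R).
Implicit Types (s : @simple_rep R k V) (D : set R) (w : V).

Lemma simple_measurable_cons p s :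
  simple_measurable (p :: s) <-> measurable p.1 /\ simple_measurable s.
Proof.
split=> [ms|[mp ms] [|i]]; [|by []|exact: ms].
by split=> [|i ilt]; [exact: (ms 0%N)|exact: (ms i.+1)].
Qed.

Lemma simple_measurable_cat s1 s2 :
  simple_measurable s1 -> simple_measurable s2 -> simple_measurable (s1 ++ s2).
Proof.
elim: s1 => //= p s1 IH /simple_measurable_cons[mp ms1] ms2.
by apply/simple_measurable_cons; split=> //; exact: IH.
Qed.

Lemma simple_eval_cons p s x :
  simple_eval (p :: s) x = (\1_(p.1) x : K) *: p.2 + simple_eval s x.
Proof. by rewrite /simple_eval big_cons. Qed.

Lemma simple_integral_cons D p s : simple_integral D (p :: s) =
  of_real k (fine (leb (p.1 `&` D))) *: p.2 + simple_integral D s.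
Proof. by rewrite /simple_integral big_cons. Qed.

Lemma simple_eval_cat s1 s2 x :
  simple_eval (s1 ++ s2) x = simple_eval s1 x + simple_eval s2 x.
Proof. by rewrite /simple_eval big_cat. Qed.

Lemma simple_integral_cat D s1 s2 : simple_integral D (s1 ++ s2) =
  simple_integral D s1 + simple_integral D s2.
Proof. by rewrite /simple_integral big_cat. Qed.

(** Represents x |-> c s(phi x). With [phi] the identity and [c] = -1 it is the negative of [s],
    which turns differences into concatenations; with [phi] a reflection it reverses time. *)
Definition simple_pullback (phi : R -> R) (c : K) s : @simple_rep R k V :=
  [seq (phi @^-1` p.1, c *: p.2) | p <- s].

Lemma simple_measurable_pullback (phi : R -> R) c s :
  (forall A : set R, measurable A -> measurable (phi @^-1` A)) ->
  simple_measurable s -> simple_measurable (simple_pullback phi c s).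
Proof.
move=> mphi; elim: s => //= p s IH /simple_measurable_cons[mp ms].
by apply/simple_measurable_cons; split; [exact: mphi|exact: IH].
Qed.

Lemma simple_eval_pullback phi c s x :
  simple_eval (simple_pullback phi c s) x = c *: simple_eval s (phi x).
Proof.
rewrite /simple_eval big_map scaler_sumr; apply: eq_bigr => p _.
by rewrite /= !scalerA mulrC !indicE.
Qed.

Lemma simple_integral_pullback (phi : R -> R) c s D : measurable D ->
  (forall A : set R, measurable A -> leb (phi @^-1` A) = leb A) ->
  phi @^-1` D = D -> simple_measurable s ->
  simple_integral D (simple_pullback phi c s) = c *: simple_integral D s.
Proof.
move=> mD phi_leb phiD; elim: s => [|p s IH].
  by rewrite /simple_integral !big_nil scaler0.
move=> /simple_measurable_cons[mp ms]; rewrite /= !simple_integral_cons IH//=.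
rewrite scalerDr !scalerA mulrC -{1}phiD -preimage_setI phi_leb//.
exact: measurableI.
Qed.

(** A simple function has finitely many values, each taken on a measurable set, so [P] can be
    arbitrary. The shift [w] collects the vectors of the sets already treated by the induction. *)
Lemma measurable_preimage_simple_eval w s (P : set V) :
  simple_measurable s -> measurable [set x | P (w + simple_eval s x)].
Proof.
elim: s w => [w _|[E v] s IH w /simple_measurable_cons[/= mE ms]].
  rewrite /simple_eval; under eq_set do rewrite big_nil.
  have [Pw|Pw] := pselect (P (w + 0)).
    by rewrite (_ : [set _ | _] = setT)//; apply/seteqP; split.
  by rewrite (_ : [set _ | _] = set0)//; apply/seteqP; split.
rewrite (_ : [set _ | _] =
    (E `&` [set x | P ((w + v) + simple_eval s x)]) `|`
    (~` E `&` [set x | P (w + simple_eval s x)])).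
  by apply: measurableU; apply: measurableI;
    [|exact: IH|exact: measurableC|exact: IH].
apply/seteqP; split=> x /=; rewrite simple_eval_cons/= indicE.
  case: (boolP (x \in E)) => xE.
    by rewrite scale1r addrA; left; split=> //; exact/set_mem.
  by rewrite scale0r add0r; right; split => //; move/negP: xE; rewrite inE.
case: (boolP (x \in E)) => [/set_mem|/negP]; last rewrite inE => xE [[]|[]]//.
  by move=> xE [[]|[]]//; rewrite scale1r addrA.
by rewrite scale0r add0r.
Qed.

Lemma measurable_rnorm_simple_eval D w s : simple_measurable s ->
  measurable_fun D (fun x => (rnorm (w + simple_eval s x))%:E).
Proof.
move=> ms; apply/measurable_EFinP => mD Y mY; apply: measurableI => //.
exact: (measurable_preimage_simple_eval w [set v | Y (rnorm v)] ms).
Qed.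

(* Splitting D along the first set of s absorbs its vector into the constant w;
   this makes disjoint representatives unnecessary. *)
Lemma ler_rnorm_simple_integral D w s :
  measurable D -> (leb D < +oo)%E -> simple_measurable s ->
  ((rnorm (of_real k (fine (leb D)) *: w + simple_integral D s))%:E <=
   \int[leb]_(x in D) (rnorm (w + simple_eval s x))%:E)%E.
Proof.
elim: s D w => [|[E v] s IH] D w mD Doo.
  move=> _; rewrite /simple_integral big_nil addr0.
  rewrite (eq_integral (cst (rnorm w)%:E)); last first.
    by move=> x _; rewrite /simple_eval big_nil addr0.
  rewrite integral_cst// rnormZ_real ?fine_ge0// mulrC EFinM fineK//.
  by rewrite ge0_fin_numE.
move=> /[dup] msE /simple_measurable_cons[/= mE ms].
have mDE : measurable (D `&` E) by exact: measurableI.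
have mDE' : measurable (D `\` E) by exact: measurableD.
have DEoo : (leb (D `&` E) < +oo)%E.
  by apply: le_lt_trans Doo; rewrite le_measure ?inE.
have DE'oo : (leb (D `\` E) < +oo)%E.
  by apply: le_lt_trans Doo; rewrite le_measure ?inE.
(* Additivity of the simple integral in the domain; finite measure makes [fine] additive. *)
have splitI s' : simple_measurable s' -> simple_integral D s' =
    simple_integral (D `&` E) s' + simple_integral (D `\` E) s'.
  elim: s' => [|p s' IHs']; first by rewrite /simple_integral !big_nil addr0.
  move=> /simple_measurable_cons[mp ms']; rewrite !simple_integral_cons IHs'//.
  rewrite addrACA -scalerDl -of_realD; congr (of_real k _ *: _ + _).
  have fin A : measurable A -> A `<=` D -> leb A \is a fin_num.
    move=> mA AD; rewrite ge0_fin_numE//.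
    by rewrite (le_lt_trans _ Doo)// le_measure ?inE.
  rewrite -fineD.
  - congr fine; rewrite -measureU//; try exact: measurableI.
      by rewrite -setIUr setUIDK.
    by apply/seteqP; split=> // x [[_ [_ ?]] [_ []]].
  - apply: fin; first exact: measurableI.
    by move=> x [_ []].
  - apply: fin; first exact: measurableI.
    by move=> x [_ []].
rewrite -[X in (_ <= integral _ X _)%E](setUIDK D E).
rewrite ge0_integral_setU//; last 3 first.
- exact: measurable_rnorm_simple_eval.
- by move=> x _; rewrite lee_fin rnorm_ge0.
- by apply/disj_setPS => x [[_ ?] []].
(* On [D] inside [E] the head contributes [v] everywhere, so the induction hypothesis is used at
   [w + v]; outside [E] it contributes nothing and [w] stays. *)
have IHI : ((rnorm (of_real k (fine (leb (D `&` E))) *: (w + v) +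
      simple_integral (D `&` E) s))%:E <=
    \int[leb]_(x in D `&` E) (rnorm (w + simple_eval ((E, v) :: s) x))%:E)%E.
  apply: (le_trans (IH _ (w + v) mDE DEoo ms)).
  rewrite le_eqVlt; apply/orP; left; apply/eqP/eq_integral => x.
  by rewrite inE => -[_ xE];
    rewrite simple_eval_cons indicE mem_set//= scale1r addrA.
have IHD : ((rnorm (of_real k (fine (leb (D `\` E))) *: w +
      simple_integral (D `\` E) s))%:E <=
    \int[leb]_(x in D `\` E) (rnorm (w + simple_eval ((E, v) :: s) x))%:E)%E.
  apply: (le_trans (IH _ w mDE' DE'oo ms)).
  rewrite le_eqVlt; apply/orP; left; apply/eqP/eq_integral => x.
  by rewrite inE => -[_ xE];
    rewrite simple_eval_cons indicE memNset//= scale0r add0r.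
apply: le_trans (leeD IHI IHD).
(* The triangle inequality joins the two pieces; what remains is an identity of vectors, from the
   additivity of measure and integral over the splitting. *)
rewrite -EFinD lee_fin; apply: le_trans (ler_rnormD _ _).
rewrite simple_integral_cons/= splitI//.
set a := leb (D `&` E); set b := leb (D `\` E).
have -> : leb D = (a + b)%E.
  rewrite -measureU// ?setUIDK//.
  by apply/seteqP; split=> // x [[_ ?] []].
rewrite fineD ?ge0_fin_numE ?measure_ge0// (setIC E) -/a.
rewrite of_realD scalerDl addrACA.
by rewrite scalerDr -(addrA (_ + _)) (addrCA (simple_integral (D `&` E) s)).
Qed.

End SimpleFunctions.

(** * Uniqueness and reflection of Bochner integrals *)

Section Bochner.
Context {R : realType} {k : scalar_kind} {V : normedModType (scalars R k)}.
Local Notation K := (scalars R k).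
Local Notation leb := (@lebesgue_measure R).
Implicit Types (D : set R) (f : R -> V).

(** [f] is only an almost-everywhere limit of simple functions. This supplies a measurable
    substitute for its distance to [r], to which additivity, homogeneity and change of variables of
    the integral apply. *)
Lemma simple_approx_dist D f (s : nat -> simple_rep) (r : simple_rep) :
  simple_approx D f s -> simple_measurable r ->
  exists g : R -> \bar R, [/\ measurable_fun setT g, (forall x, 0 <= g x)%E &
    {ae leb, forall x, D x -> (rnorm (f x - simple_eval r x))%:E = g x}].
Proof.
move=> [ms sf] mr.
pose h n x := (rnorm (simple_eval (s n) x - simple_eval r x))%:E.
have mh n : measurable_fun setT (h n).
  rewrite (_ : h n = fun x =>
    (rnorm (0 + simple_eval (s n ++ simple_pullback id (- 1) r) x))%:E).
    apply: measurable_rnorm_simple_eval; apply: simple_measurable_cat => //.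
    exact: simple_measurable_pullback.
  apply/funext => x.
  by rewrite add0r simple_eval_cat simple_eval_pullback scaleN1r.
(* The upper limit is measurable and equals the limit wherever the approximation converges; the
   absolute value gives nonnegativity at every point. *)
exists (fun x => `|limn_esup (h ^~ x)|%E); split=> //.
  apply: measurableT_comp => //; exact: measurable_fun_limn_esup.
apply: ae_lebesgueS sf => x sfx Dx.
suff /cvg_limn_einf_sup[_ ->] : h n x @[n --> \oo] -->
    (rnorm (f x - simple_eval r x))%:E by rewrite gee0_abs// lee_fin rnorm_ge0.
apply: cvg_EFin; first by near=> n.
have /cvg_rnormP h0 := sfx Dx.
apply/cvgrPdist_le => e e0.
move/cvgrPdist_le : h0 => /(_ _ e0); apply: filterS => n.
rewrite sub0r normrN ger0_norm ?rnorm_ge0//; apply: le_trans.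
by apply: le_trans (ler_rnorm_dist _ _) _; rewrite opprB addrA subrK.
Unshelve. all: by end_near. Qed.

(** For approximations s_n and s'_n with simple integrals I(s_n) and I(s'_n), |v - v'| is at most |v
    - I(s_n)| + |I(s_n) - I(s'_n)| + |I(s'_n) - v'|. The middle term is at most the integral of |f -
    s_n| plus that of |f - s'_n|, so the whole bound tends to 0. *)
Lemma bochner_integral_unique D f v v' : measurable D -> (leb D < +oo)%E ->
  is_bochner_integral D f v -> is_bochner_integral D f v' -> v = v'.
Proof.
move=> mD Doo [s [sf sf0 sv]] [s' [sf' sf0' sv']].
apply/eqP; rewrite -subr_eq0; apply/eqP/rnorm_eq0/eqP.
rewrite eq_le rnorm_ge0 andbT -lee_fin.
pose dist (r : nat -> @simple_rep R k V) n :=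
  (\int[leb]_(x in D) (rnorm (f x - simple_eval (r n) x))%:E)%E.
pose err (r : nat -> @simple_rep R k V) (w : V) n :=
  (rnorm (w - simple_integral D (r n)))%:E.
have err0 r w : simple_integral D (r n) @[n --> \oo] --> w ->
    err r w n @[n --> \oo] --> 0%E.
  by move=> /cvg_rnormP rw; apply: cvg_EFin => //; near=> n.
have cvg0 : ((err s v n + dist s n) + (err s' v' n + dist s' n))%E
    @[n --> \oo] --> 0%E.
  rewrite -[X in _ --> X]adde0; apply: cvgeD => //;
    rewrite -[X in _ --> X]adde0; apply: cvgeD => //; exact: err0.
rewrite -[leRHS](cvg_lim _ cvg0)//; apply: lime_ge.
  by apply/cvg_ex; exists 0%E.
apply: nearW => n.
have [ms _] := sf; have [ms' _] := sf'.
have [g [mg g0 gE]] := simple_approx_dist sf (ms n).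
have [g' [mg' g'0 g'E]] := simple_approx_dist sf (ms' n).
have distE : (dist s n + dist s' n = \int[leb]_(x in D) (g x + g' x))%E.
  rewrite ge0_integralD//; try exact: measurable_funTS.
  by congr (_ + _)%E; apply: ae_eq_nonneg_integral => // x _;
    rewrite lee_fin rnorm_ge0.
have ssE : ((rnorm (simple_integral D (s n) - simple_integral D (s' n)))%:E
    <= dist s n + dist s' n)%E.
  (* [r] represents the difference of the two simple functions; the norm inequality for simple
     integrals is applied to it with zero shift. *)
  pose r := s n ++ simple_pullback id (- 1) (s' n).
  have mr : simple_measurable r.
    by apply: simple_measurable_cat => //; exact: simple_measurable_pullback.
  have := ler_rnorm_simple_integral 0 mD Doo mr.
  rewrite scaler0 add0r simple_integral_cat simple_integral_pullback// scaleN1r.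
  move=> /le_trans; apply; rewrite distE; apply: ae_le_nonneg_integral => //.
  - by move=> x _; rewrite lee_fin rnorm_ge0.
  - by move=> x _; rewrite adde_ge0.
  apply: ae_lebesgueS2 gE g'E => x gx g'x Dx.
  rewrite -gx// -g'x// -EFinD lee_fin.
  rewrite add0r simple_eval_cat simple_eval_pullback scaleN1r.
  rewrite (rnorm_distC (f x)).
  by apply: le_trans (ler_rnormD _ _); rewrite addrA subrK.
rewrite addeACA; apply: le_trans (leeD (lexx _) ssE).
rewrite -!EFinD lee_fin (rnorm_distC v').
rewrite addrAC; apply: le_trans (lerD (ler_rnormD _ _) (lexx _)).
apply: le_trans (ler_rnormD _ _).
by rewrite !subrKA lexx.
Unshelve. all: by end_near. Qed.

Lemma simple_approx_reflect_at (t : R) f (s : nat -> simple_rep) (c : K) :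
  simple_approx `]0, t[ f s ->
  simple_approx `]0, t[ (fun x => c *: f (t - x))
    (fun n => simple_pullback (reflect_at t) c (s n)).
Proof.
move=> [ms sf]; split=> [n|].
  by apply: simple_measurable_pullback => // A;
    exact: measurable_preimage_reflect_at.
have := ae_reflect_at t sf; apply: ae_lebesgueS => x fx xt.
under eq_fun do rewrite simple_eval_pullback.
apply: cvgZr; exact/fx/reflect_at_itv_mem.
Qed.

Lemma bochner_integral_reflect_at (t : R) f v (c : K) :
  is_bochner_integral `]0, t[ f v ->
  is_bochner_integral `]0, t[ (fun x => c *: f (t - x)) (c *: v).
Proof.
move=> [s [sf sf0 sv]].
exists (fun n => simple_pullback (reflect_at t) c (s n)).
have [ms _] := sf.
split; first exact: simple_approx_reflect_at.
- pose a := re_part `|c|.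
  have a0 : 0 <= a by rewrite -(ler_of_real (k := k)) of_real0 re_partK.
  have : (a%:E * \int[leb]_(x in `]0%R, t[)
      (rnorm (f x - simple_eval (s n) x))%:E)%E @[n --> \oo] --> 0%E.
    by rewrite -[X in _ --> X](mule0 a%:E); exact: cvgeZl.
  apply: cvg_trans; apply: near_eq_cvg; apply: nearW => n.
  (* The error integral passes through its measurable substitute [g], so that it can be reflected
     and the factor |c| moved inside. *)
  have [g [mg g0 gE]] := simple_approx_dist sf (ms n).
  have fg : (\int[leb]_(x in `]0%R, t[) (rnorm (f x - simple_eval (s n) x))%:E =
      \int[leb]_(x in `]0%R, t[) g x)%E.
    by apply: ae_eq_nonneg_integral => // x _; rewrite lee_fin rnorm_ge0.
  rewrite fg -(integral_reflect_at (measurable_funTS mg) g0).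
  rewrite -ge0_integralZl_EFin//; last first.
    apply: measurable_funTS; apply: measurableT_comp => //.
    exact: measurable_reflect_at.
  apply/esym/ae_eq_nonneg_integral => //.
  - by move=> x _; rewrite lee_fin rnorm_ge0.
  - by move=> x _; rewrite mule_ge0.
  have := ae_reflect_at t gE; apply: ae_lebesgueS => x gx xt.
  rewrite simple_eval_pullback -scalerBr rnormZ EFinM gx//.
  exact: reflect_at_itv_mem.
- rewrite (_ : (fun n => _) = fun n => c *: simple_integral `]0, t[ (s n)).
    exact: cvgZr.
  apply/funext => n; apply: simple_integral_pullback => //.
    by move=> A; exact: lebesgue_measure_reflect_at.
  exact: reflect_at_itv.
Qed.

End Bochner.

(** * Class K functions *)

Section ClassK.
Context {R : realType}.
Implicit Types (f : R -> R) (x y m : R).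

Lemma class_K_homo f x y : class_K f -> 0 <= x -> x <= y -> f x <= f y.
Proof.
move=> [_ f_incr _] x0; rewrite le_eqVlt => /orP[/eqP->//|xy].
exact/ltW/f_incr.
Qed.

Lemma class_K_ge0 f x : class_K f -> 0 <= x -> 0 <= f x.
Proof.
by move=> fK x0; have [_ _ <-] := fK; exact: class_K_homo.
Qed.

Lemma class_K_cvg0 f m : class_K f -> 0 <= m ->
  f (t * m) @[t --> 0^'+] --> 0.
Proof.
move=> fK m0; apply/cvgrPdist_lt => e e0.
have [fcont _ f0] := fK.
have [_ f_right] := (continuous_within_itvcyP _ _).1 fcont.
move/cvgrPdist_lt : f_right => /(_ _ e0) fe.
have [y y0 fye] : exists2 y, 0 < y & f y < e.
  near (0 : R)^'+ => y; exists y; first by near: y; exact: nbhs_right_gt.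
  have : `|f 0 - f y| < e by near: y.
  rewrite f0 sub0r normrN ger0_norm// class_K_ge0//.
(* [m] may be 0, so the threshold for t is y / (m + 1). *)
have m1 : 0 < m + 1 by rewrite ltr_wpDl.
near=> t; have t0 : 0 < t by near: t; exact: nbhs_right_gt.
have tm0 : 0 <= t * m by rewrite mulr_ge0// ltW.
rewrite sub0r normrN ger0_norm ?(class_K_ge0 fK)//.
apply: le_lt_trans fye; apply: class_K_homo => //.
apply: (@le_trans _ _ (t * (m + 1))); first by rewrite ler_pM2l// lerDl.
rewrite -ler_pdivlMr//; near: t; apply: nbhs_right_le; exact: divr_gt0.
Unshelve. all: by end_near. Qed.

End ClassK.

(** * Essential bounds on inputs *)

Section EssentialSupremum.
Context {R : realType} {k : scalar_kind} {U : normedModType (scalars R k)}.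
Local Notation K := (scalars R k).
Local Notation leb := (@lebesgue_measure R).
Implicit Types (t M : R) (u : R -> U).

Lemma Loo_norm_ge0 t u : (0 <= Loo_norm t u)%E.
Proof.
apply: ess_sup_gee.
  (* A pointwise lower bound passes to the essential supremum because the whole line has positive
     measure. *)
  suff : (0 < leb [set` `]-oo, +oo[%R])%E by rewrite set_itvNyy.
  by rewrite lebesgue_measure_itv/= ltry.
by apply: (@aeW _ _ _ leb) => x; rewrite lee_fin mulr_ge0// ?rnorm_ge0// indicE.
Qed.

Lemma Loo_norm_le t u M : 0 <= M ->
  {ae leb, forall x, `]0, t[%classic x -> rnorm (u x) <= M} ->
  (Loo_norm t u <= M%:E)%E.
Proof.
move=> M0 uM; apply/ess_supP; move: uM; apply: ae_lebesgueS => x uM.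
rewrite lee_fin indicE; case: (boolP (x \in `]0, t[%classic)) => xt.
  by rewrite mul1r; apply/uM/set_mem.
by rewrite mul0r.
Qed.

Lemma ae_le_Loo_norm t u : (Loo_norm t u < +oo)%E ->
  {ae leb, forall x, `]0, t[%classic x -> rnorm (u x) <= fine (Loo_norm t u)}.
Proof.
move=> uoo.
have := ess_sup_ge leb (fun x => (\1_(`]0, t[%classic) x * rnorm (u x))%:E).
apply: ae_lebesgueS => x ux xt; rewrite -lee_fin fineK; last first.
  by rewrite ge0_fin_numE ?Loo_norm_ge0.
by move: ux; rewrite indicE mem_set// mul1r.
Qed.

Lemma ae_le_reflect_at t u (c : K) M :
  {ae leb, forall x, `]0, t[%classic x -> rnorm (u x) <= M} ->
  {ae leb, forall x, `]0, t[%classic x ->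
    rnorm (c *: u (t - x)) <= re_part `|c| * M}.
Proof.
move=> uM; have := ae_reflect_at t uM; apply: ae_lebesgueS => x ux xt.
rewrite rnormZ ler_wpM2l//; last exact/ux/reflect_at_itv_mem.
by rewrite -(ler_of_real (k := k)) of_real0 re_partK.
Qed.

Lemma in_Loo_reflect_at t u (c : K) :
  in_Loo t u -> in_Loo t (fun x => c *: u (t - x)).
Proof.
move=> [[s us] uoo]; split.
  by exists (fun n => simple_pullback (reflect_at t) c (s n));
    exact: simple_approx_reflect_at.
have := ae_le_reflect_at c (ae_le_Loo_norm uoo).
move=> /Loo_norm_le/le_lt_trans-> //; last by rewrite ltry.
rewrite mulr_ge0 ?fine_ge0 ?Loo_norm_ge0//.
by rewrite -(ler_of_real (k := k)) of_real0 re_partK.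
Qed.

(** The integrand is at most [mu M] almost everywhere. The lower bound is stated too because class K
    functions, such as the [theta] applied to this integral, are monotone only on [0, oo). *)
Lemma Rintegral_class_K_bounds t u M (mu : R -> R) : class_K mu -> 0 <= t ->
  {ae leb, forall x, `]0, t[%classic x -> rnorm (u x) <= M} -> 0 <= M ->
  0 <= \int[leb]_(s in `]0, t[) mu (rnorm (u s)) <= t * mu M.
Proof.
move=> muK t0 uM M0.
have mu0 x : (0 <= (mu (rnorm (u x)))%:E)%E.
  by rewrite lee_fin class_K_ge0// rnorm_ge0.
rewrite fine_ge0 ?integral_ge0//=.
have le_int : (\int[leb]_(s in `]0%R, t[) (mu (rnorm (u s)))%:E <=
    (t * mu M)%:E)%E.
  apply: (@le_trans _ _ (\int[leb]_(s in `]0%R, t[) (cst (mu M)%:E) s)%E).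
    apply: ae_le_nonneg_integral => //.
      by move=> x _; rewrite lee_fin class_K_ge0.
    apply: ae_lebesgueS uM => x ux xt.
    by rewrite lee_fin class_K_homo ?rnorm_ge0//; exact: ux.
  rewrite integral_cst// [X in (_ * X)%E](_ : _ = t%:E) -?EFinM 1?mulrC//.
  apply: etrans (lebesgue_measure_itv `]0, t[) _.
  rewrite /= lte_fin -EFinD subr0; case: ifPn => //.
  by rewrite -leNgt => t0'; congr EFin; apply/eqP; rewrite eq_le t0 t0'.
(* The bound makes the extended integral finite, so [fine] returns its true value. *)
rewrite -lee_fin fineK// ge0_fin_numE ?integral_ge0//.
by rewrite (le_lt_trans le_int)// ltry.
Qed.

End EssentialSupremum.

(** The norm of [iota x] is that of [S x], and the resolvent [S] is injective because b - A is a
    left inverse of it. *)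
Lemma extrapolation_injective (R : realType) (k : scalar_kind)
    (X : normedModType (scalars R k)) (A : operator X)
    (W : completeNormedModType (scalars R k)) (iota : {linear X -> W}) :
  is_extrapolation_space A iota -> injective iota.
Proof.
move=> [[b [S [[_ Sdom _] iotaS]]] _] x y xy.
have Sxy : S (x - y) = S 0.
  rewrite linear0; apply: rnorm_eq0.
  by rewrite -iotaS linearB xy subrr rnorm0.
apply/eqP; rewrite -subr_eq0; apply/eqP.
(* [op A] is a bare function, so its value at [S 0] is read off from the resolvent identity at 0. *)
have [_ <-] := Sdom (x - y); rewrite Sxy.
by have [_ ->] := Sdom 0.
Qed.

(** * From the zero-state estimate to zero-class admissibility *)

Section ZeroClass.
Context {R : realType} {k : scalar_kind}.
Local Notation K := (scalars R k).
Context {X U : normedModType K} {Xm1 : normedModType K}.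
Context {T : R -> {linear X -> X}} {iota : {linear X -> Xm1}}.
Context {Tm1 : R -> {linear Xm1 -> Xm1}} {B : {linear U -> Xm1}}.
Local Notation leb := (@lebesgue_measure R).

Definition zero_state_estimate (theta mu : R -> R) : Prop :=
  forall (t : R) (u : R -> U), 0 <= t -> in_Loo t u ->
    exists2 x : X, is_mild_solution_at T iota Tm1 B 0 u t (iota x) &
      rnorm x <= theta (\int[leb]_(s in `]0, t[) mu (rnorm (u s))).

(** The estimate is applied to the input s |-> a u(t - s), essentially bounded by [M], and the
    result is divided by [a]. Keeping [a] and [M] free covers both the normalized input and the
    input of norm zero. *)
Lemma input_integral_scaled_bound (theta mu : R -> R) (t a M : R) (u : R -> U) :
  class_K theta -> class_K mu -> zero_state_estimate theta mu ->
  0 <= t -> 0 < a -> a * fine (Loo_norm t u) <= M -> in_Loo t u ->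
  exists2 x, is_input_integral iota Tm1 B t u x &
    rnorm x <= a^-1 * theta (t * mu M).
Proof.
move=> thetaK muK iISS t0 a0 aM uoo.
pose c := of_real k a.
have c0 : c != 0 by rewrite gt_eqF// -of_real0 ltr_of_real.
have cV : c^-1 = of_real k a^-1.
  by apply: (mulfI c0); rewrite mulfV// -of_realM mulfV ?gt_eqF// of_real1.
have [x [v vint xv] xle] := iISS t _ t0 (in_Loo_reflect_at c uoo).
(* With zero initial state the mild solution is the integral [v] itself. *)
move: xv; rewrite !linear0 add0r => xv.
exists (c^-1 *: x).
  rewrite /is_input_integral linearZ/= xv.
  (* A second reflection restores s from t - s, and the factor [c^-1] cancels [c]. *)
  have := bochner_integral_reflect_at c^-1 vint; congr is_bochner_integral.
  apply/funext => s; rewrite opprB addrC subrK.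
  by rewrite !linearZ/= scalerA mulfV// scale1r.
have aV0 : 0 <= a^-1 by rewrite invr_ge0 ltW.
rewrite cV rnormZ_real// ler_wpM2l//.
apply: (le_trans xle).
have M0 : 0 <= M.
  by apply: le_trans aM; rewrite mulr_ge0 ?fine_ge0 ?Loo_norm_ge0// ltW.
have uM : {ae leb, forall x, `]0, t[%classic x -> rnorm (c *: u (t - x)) <= M}.
  have := ae_le_reflect_at c (ae_le_Loo_norm uoo.2).
  apply: ae_lebesgueS => s us st; apply: le_trans aM.
  move: (us st); rewrite ger0_norm ?of_realK//.
  by rewrite -of_real0 ler_of_real ltW.
have /andP[int0 intM] := Rintegral_class_K_bounds muK t0 uM M0.
exact: class_K_homo.
Qed.

Lemma input_integral_bound (theta mu : R -> R) (t : R) (u : R -> U) :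
  class_K theta -> class_K mu -> zero_state_estimate theta mu ->
  0 <= t -> in_Loo t u ->
  exists2 x, is_input_integral iota Tm1 B t u x &
    rnorm x <= theta (t * mu 1) * fine (Loo_norm t u).
Proof.
move=> thetaK muK iISS t0 uoo.
(* An input of norm zero cannot be normalized; there [a] = 1 and [M] = 0 give the bound theta(t
   mu(0)) = 0. *)
have := fine_ge0 (Loo_norm_ge0 t u); rewrite le_eqVlt => /orP[/eqP u0|u0].
  have := @input_integral_scaled_bound
    theta mu t 1 0 u thetaK muK iISS t0 ltr01.
  rewrite -u0 mulr0 => /(_ (lexx _) uoo)[x ux xle]; exists x => //.
  have [_ _ mu0] := muK; have [_ _ theta0] := thetaK.
  by move: xle; rewrite mu0 mulr0 theta0 !mulr0.
(* Otherwise [a] is the inverse of the norm of u and [M] = 1. *)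
have Nu0 : 0 < (fine (Loo_norm t u))^-1 by rewrite invr_gt0.
have := @input_integral_scaled_bound theta mu t _ 1 u thetaK muK iISS t0 Nu0.
rewrite mulVf ?gt_eqF// invrK mulrC; exact.
Qed.

End ZeroClass.

Theorem proposition2p12 (R : realType) (k : scalar_kind)
    (X U : completeNormedModType (scalars R k))
    (A : operator X) (T : R -> {linear X -> X})
    (hT : C0_semigroup T) (hA : generates A T)
    (Xm1 : completeNormedModType (scalars R k)) (iota : {linear X -> Xm1})
    (hXm1 : is_extrapolation_space A iota)
    (Tm1 : R -> {linear Xm1 -> Xm1})
    (hTm1 : is_extrapolated_semigroup T iota Tm1)
    (B : {linear U -> Xm1}) (hB : bounded_operator B) :
  Loo_iISS T iota Tm1 B -> Loo_zero_class_admissible iota Tm1 B.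
Proof.
move=> [beta [theta [mu [betaKL [thetaK _] muK iISS]]]].
have est : zero_state_estimate
    (T := T) (iota := iota) (Tm1 := Tm1) (B := B) theta mu.
  move=> t u t0 uoo; have [x mild xle] := iISS t 0 u t0 uoo; exists x => //.
  have [_ _ beta0] := betaKL.1 t t0.
  by move: xle; rewrite rnorm0 beta0 add0r.
split=> [t u t0 uoo|].
  have [x ux _] := input_integral_bound thetaK muK est (ltW t0) uoo.
  by exists x.
have mu1 : 0 <= mu 1 by exact: class_K_ge0.
apply: (@squeeze_cvge _ _ _ _ (cst 0%E) _ (fun t => (theta (t * mu 1))%:E)).
- near=> t; have t0 : 0 <= t by apply: ltW; near: t; exact: nbhs_right_gt.
  apply/andP; split.
    by apply: le_ereal_inf_tmp => _ [c [c0 _] <-]; rewrite lee_fin.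
  (* theta(t mu(1)) is itself an admissible constant, so the infimum lies below it. *)
  apply: ereal_inf_lbound; exists (theta (t * mu 1)) => //; split.
    by rewrite class_K_ge0// mulr_ge0.
  move=> u uoo x ux.
  (* The bound is known for one value [y] of the input integral; uniqueness carries it to the given
     value [x]. *)
  have [y uy yle] := input_integral_bound thetaK muK est t0 uoo.
  suff -> : x = y by [].
  apply: (extrapolation_injective hXm1).
  apply: bochner_integral_unique ux uy => //.
  by rewrite lebesgue_measure_itv/=; case: ifP => // _; rewrite ltry.
- exact: cvg_cst.
- by apply: cvg_EFin; [near=> t|exact: class_K_cvg0].
Unshelve. all: by end_near. Qed.
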